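(* There exists no smooth homomorphism from the Poincaré group onto the group of translations of the real line; that is, there is no surjective smooth group homomorphism $\varphi:G\to(\mathbf{R},+)$, where $G$ is the Poincaré group.
   Context: The Poincaré group $G$ is the identity component of the Lie group of affine transformations $X\mapsto LX+C$ of $\mathbf{R}^4$, where $C\in\mathbf{R}^4$ and $L$ is a linear automorphism of $\mathbf{R}^4$ preserving the quadratic form $x^2+y^2+z^2-t^2$; thus $L$ ranges over the identity component of the Lorentz group $\mathrm{O}(3,1)$. The group law is composition. *)

(* Defs.v *)
From HB Require Import structures.
From mathcomp Require Import all_boot all_order all_algebra.
From mathcomp Require Import all_classical all_reals all_analysis.

Set Implicit Arguments.
Unset Strict Implicit.
Unset Printing Implicit Defensive.

Import Order.TTheory GRing.Theory Num.Theory.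
Import numFieldNormedType.Exports.

Local Open Scope classical_set_scope.
Local Open Scope ring_scope.

(* f is k times continuously differentiable on U.  For V of finite dimension
   and U open, having continuous directional derivatives of all orders up to k
   is the usual notion (equivalently: continuous partial derivatives). *)
Fixpoint is_Ck (R : realType) (V : normedModType R) (k : nat)
    (U : set V) (f : V -> R) : Prop :=
  (forall x, U x -> {for x, continuous f}) /\
  (if k is k'.+1 then
     (forall x v, U x -> derivable f x v) /\
     (forall v, is_Ck k' U (fun x => 'D_v f x))
   else True).

(* Smoothness on an arbitrary subset S of V: locally, f coincides on S with a
   smooth function defined on an open subset of V.  On an embedded submanifold
   S this is smoothness for the induced manifold structure; it depends only on
   the values of f on S. *)
Definition smooth_on (R : realType) (V : normedModType R)
    (S : set V) (f : V -> R) : Prop :=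
  forall x, S x -> exists (U : set V) (F : V -> R),
    [/\ open U, U x, forall k, is_Ck k U F &
        forall y, S y -> U y -> f y = F y].

(* The pair (L, C) stands for the map X |-> L X + C of R^4.  The space of pairs
   is a finite-dimensional normed space, whose topology and smooth structure
   are those of the affine group, an open subset of it. *)
Definition affine (R : realType) : normedModType R :=
  ('M[R]_4 * 'cV[R]_4)%type.

Definition affine_app (R : realType) (g : affine R) (X : 'cV[R]_4) : 'cV[R]_4 :=
  g.1 *m X + g.2.

Definition affine_mul (R : realType) (g h : affine R) : affine R :=
  (g.1 *m h.1, g.1 *m h.2 + g.2).

Definition affine_one (R : realType) : affine R := (1%:M, 0).

Definition affine_inv (R : realType) (g : affine R) : affine R :=
  (invmx g.1, - (invmx g.1 *m g.2)).

(* x^2 + y^2 + z^2 - t^2, with X = (x, y, z, t) *)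
Definition lorentz_form (R : realType) (X : 'cV[R]_4) : R :=
  X 0 0 ^+ 2 + X 1 0 ^+ 2 + X 2 0 ^+ 2 - X 3 0 ^+ 2.

Definition lorentz_affine (R : realType) : set (affine R) :=
  [set g : affine R | g.1 \in unitmx /\
     forall X : 'cV[R]_4, lorentz_form (g.1 *m X) = lorentz_form X].
Arguments lorentz_affine : clear implicits.

Definition poincare (R : realType) : set (affine R) :=
  connected_component (lorentz_affine R) (affine_one R).
Arguments poincare : clear implicits.

Lemma affine_app_mul (R : realType) (g h : affine R) (X : 'cV[R]_4) :
  affine_app (affine_mul g h) X = affine_app g (affine_app h X).
Proof. by rewrite /affine_app /= mulmxDr mulmxA addrA. Qed.

Lemma affine_app_one (R : realType) (X : 'cV[R]_4) :
  affine_app (affine_one R) X = X.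
Proof. by rewrite /affine_app /= mul1mx addr0. Qed.

Lemma affine_app_inj (R : realType) (g h : affine R) :
  affine_app g =1 affine_app h -> g = h.
Proof.
case: g h => [L C] [M D] e.
have eC : C = D by have := e 0; rewrite /affine_app /= !mulmx0 !add0r.
rewrite -{}eC in e *; congr (_, _).
apply/matrixP => i j; have /addIr := e (delta_mx j 0).
by rewrite -!colE => /matrixP/(_ i 0); rewrite !mxE.
Qed.

Lemma affine_mulVg (R : realType) (g : affine R) :
  g.1 \in unitmx -> affine_mul (affine_inv g) g = affine_one R.
Proof. by move=> u; rewrite /affine_mul /= mulVmx// subrr. Qed.

Lemma affine_mulgV (R : realType) (g : affine R) :
  g.1 \in unitmx -> affine_mul g (affine_inv g) = affine_one R.
Proof. by move=> u; rewrite /affine_mul /= mulmxN mulKVmx// mulmxV// addNr. Qed.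

Lemma affine_mulg1 (R : realType) (g : affine R) :
  affine_mul g (affine_one R) = g.
Proof. by case: g => L C; rewrite /affine_mul /= mulmx1 mulmx0 add0r. Qed.

Lemma lorentz_affine1 (R : realType) : lorentz_affine R (affine_one R).
Proof. by split=> [|X] /=; rewrite ?unitmx1 ?mul1mx. Qed.

Lemma lorentz_affineM (R : realType) (g h : affine R) :
  lorentz_affine R g -> lorentz_affine R h -> lorentz_affine R (affine_mul g h).
Proof.
move=> [ug qg] [uh qh]; split=> [|X] /=; first by rewrite unitmx_mul ug.
by rewrite -mulmxA qg qh.
Qed.

Lemma lorentz_affineV (R : realType) (g : affine R) :
  lorentz_affine R g -> lorentz_affine R (affine_inv g).
Proof.
move=> [ug qg]; split=> [|X] /=; first by rewrite unitmx_inv.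
by rewrite -qg mulKVmx.
Qed.

Lemma continuous_mx (R : realType) (T : topologicalType) m n
    (f : T -> 'M[R]_(m.+1, n.+1)) :
  (forall i j, continuous (fun x => f x i j)) -> continuous f.
Proof.
move=> cf x.
rewrite (_ : f = fun y => \sum_i \sum_j f y i j *: delta_mx i j); last first.
  by apply/funext => y; exact: matrix_sum_delta.
apply: cvg_big => [|i _]; first exact: add_continuous.
apply: cvg_big => [|j _]; first exact: add_continuous.
by apply: cvgZr_tmp; exact: cf.
Qed.

Lemma continuous_mulmxl (R : realType) m n p (A : 'M[R]_(m.+1, n.+1)) :
  continuous (fun B : 'M[R]_(n.+1, p.+1) => A *m B).
Proof.
apply: continuous_mx => i j B.
rewrite (_ : (fun _ => _) = fun B : 'M[R]_(n.+1, p.+1) =>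
    \sum_k A i k * B k j); last by apply/funext => D; rewrite mxE.
apply: cvg_big => [||k _]; [exact: add_continuous|exact: nbhs_filter|].
by apply: cvgMl_tmp; [exact: nbhs_filter|exact: coord_continuous].
Qed.

Lemma affine_mul_continuous (R : realType) (g : affine R) :
  continuous (affine_mul g).
Proof.
move=> h.
have cL : {for h, continuous (fun h : affine R => g.1 *m h.1)}.
  apply: (@continuous_comp _ _ _ (fun h : affine R => h.1)
    (fun B : 'M[R]_4 => g.1 *m B)); first exact: cvg_fst.
  exact: continuous_mulmxl.
have cC : {for h, continuous (fun h : affine R => g.1 *m h.2)}.
  apply: (@continuous_comp _ _ _ (fun h : affine R => h.2)
    (fun B : 'cV[R]_4 => g.1 *m B)); first exact: cvg_snd.
  exact: continuous_mulmxl.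
have cD : {for h, continuous (fun h : affine R => g.1 *m h.2 + g.2)}.
  by apply: cvgD cC _; exact: cvg_cst.
exact: (cvg_pair cL cD).
Qed.

Lemma poincare_sub (R : realType) : poincare R `<=` lorentz_affine R.
Proof. exact: connected_component_sub. Qed.

Lemma poincare1 (R : realType) : poincare R (affine_one R).
Proof. exact/connected_component_refl/lorentz_affine1. Qed.

Lemma poincare_translate (R : realType) (g x y : affine R) :
  lorentz_affine R g -> connected_component (lorentz_affine R) x y ->
  connected_component (lorentz_affine R) (affine_mul g x) (affine_mul g y).
Proof.
move=> Hg [B [Bx BH cB] By]; exists (affine_mul g @` B); last by exists y.
split; first by exists x.
- by move=> _ [z Bz <-]; apply: lorentz_affineM => //; exact: BH.
- apply: connected_continuous_connected => //.
  by apply: continuous_subspaceT; exact: affine_mul_continuous.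
Qed.

Lemma poincareM (R : realType) (g h : affine R) :
  poincare R g -> poincare R h -> poincare R (affine_mul g h).
Proof.
move=> Gg Gh; apply: (connected_component_trans Gg).
rewrite -{1}(affine_mulg1 g); apply: poincare_translate => //.
exact: connected_component_sub Gg.
Qed.

Lemma poincareV (R : realType) (g : affine R) :
  poincare R g -> poincare R (affine_inv g).
Proof.
move=> Gg; have Hg := connected_component_sub Gg.
apply: connected_component_sym.
have := poincare_translate (lorentz_affineV Hg) Gg.
by rewrite affine_mulg1 affine_mulVg //; case: Hg.
Qed.

(* Main.v *)
(** Any homomorphism to the additive reals vanishes, smooth or not, because
    every element is a product of commutators and of elements conjugate to
    their inverses.  A half-turn about a suitable axis conjugates a rotation or
    boost in a coordinate plane to its inverse; it also inverts a spatial
    translation, and a boost then takes care of the time translations.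
    Gaussian elimination by rotations and boosts, column by column, reduces a
    Lorentz matrix of the identity component to a diagonal one, and positivity
    of the determinant and of the time-time entry (both are continuous and
    never 0 on the Lorentz group) makes it the identity. *)

Require Import Defs.
From HB Require Import structures.
From mathcomp Require Import all_boot all_order all_algebra.
From mathcomp Require Import all_classical all_reals all_analysis.
From mathcomp Require Import ring lra.

Import Order.TTheory GRing.Theory Num.Theory.
Import numFieldNormedType.Exports.

Local Open Scope classical_set_scope.
Local Open Scope ring_scope.

(** * Minkowski signature, plane rotations and boosts *)

Definition msign {R : realType} (i : 'I_4) : R := if i == 3 then -1 else 1.

Lemma msign_sq {R : realType} (i : 'I_4) : msign i * msign i = 1 :> R.
Proof. by rewrite /msign; case: ifP; rewrite ?mulrNN mulr1. Qed.

Lemma msign3 {R : realType} : msign 3 = -1 :> R.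
Proof. by rewrite /msign eqxx. Qed.

Lemma msign_spatial {R : realType} (i : 'I_4) : i != 3 -> msign i = 1 :> R.
Proof. by rewrite /msign => /negbTE->. Qed.

Lemma big_ord4 {R : realType} (F : 'I_4 -> R) :
  \sum_i F i = F 0 + F 1 + F 2 + F 3.
Proof.
rewrite !big_ord_recr big_ord0 /= add0r.
by congr (F _ + F _ + F _ + F _); apply/val_inj.
Qed.

Lemma ord4_ind (P : 'I_4 -> Prop) : P 0 -> P 1 -> P 2 -> P 3 -> forall i, P i.
Proof.
move=> p0 p1 p2 p3 [[|[|[|[|//]]]] h].
- by rewrite (_ : Ordinal h = 0) //; apply/val_inj.
- by rewrite (_ : Ordinal h = 1) //; apply/val_inj.
- by rewrite (_ : Ordinal h = 2) //; apply/val_inj.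
- by rewrite (_ : Ordinal h = 3) //; apply/val_inj.
Qed.

Lemma lorentz_formE {R : realType} (X : 'cV[R]_4) :
  lorentz_form X = \sum_i msign i * X i 0 ^+ 2.
Proof.
by rewrite big_ord4 /lorentz_form msign3 !msign_spatial// !mul1r mulN1r.
Qed.

(** One formula covers both kinds of plane transformation: for [i != j], [msign i * msign j] is [1]
    in a spatial plane, where [c] and [s] act as a cosine and a sine, and [-1] in a plane containing
    the time axis, where they act as their hyperbolic analogues. *)
Definition givens {R : realType} (i j : 'I_4) (c s : R) : 'M[R]_4 :=
  \matrix_(k, l) if k == i then c * (l == i)%:R + s * (l == j)%:R
    else if k == j
      then - (msign i * msign j * s) * (l == i)%:R + c * (l == j)%:R
    else (k == l)%:R.

Lemma mul_givens {R : realType} (i j : 'I_4) (c s : R) n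
    (A : 'M[R]_(4, n)) k l :
  (givens i j c s *m A) k l = if k == i then c * A i l + s * A j l
    else if k == j then - (msign i * msign j * s) * A i l + c * A j l
    else A k l.
Proof.
have pick x : \sum_m (m == x)%:R * A m l = A x l.
  rewrite (bigD1 x)//= eqxx mul1r big1 ?addr0// => m /negbTE->.
  by rewrite mul0r.
have comb a b x y :
    \sum_m (a * (m == x)%:R + b * (m == y)%:R) * A m l = a * A x l + b * A y l.
  under eq_bigr do rewrite mulrDl -!mulrA.
  by rewrite big_split/= -!mulr_sumr !pick.
rewrite mxE; under eq_bigr do rewrite mxE.
case: ifP => _; first exact: comb.
case: ifP => _; first exact: comb.
by under eq_bigr do rewrite eq_sym; exact: pick.
Qed.

(** The cross terms cancel because the signs square to [1], and the square terms pick up the factor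
    [c ^+ 2 + msign i * msign j * s ^+ 2]. *)
Lemma lorentz_form_givens {R : realType} (i j : 'I_4) (c s : R) (X : 'cV[R]_4) :
  i != j -> c ^+ 2 + msign i * msign j * s ^+ 2 = 1 ->
  lorentz_form (givens i j c s *m X) = lorentz_form X.
Proof.
move=> ij cs; rewrite !lorentz_formE.
rewrite (bigD1 i)// (bigD1 j) 1?eq_sym//= [RHS](bigD1 i)//.
rewrite [in RHS](bigD1 j) 1?eq_sym//= !addrA; congr (_ + _); last first.
  apply: eq_bigr => k /andP[/negbTE ki /negbTE kj].
  by rewrite mul_givens ki kj.
rewrite !mul_givens !eqxx [j == i]eq_sym (negbTE ij).
have ei := msign_sq i (R := R); have ej := msign_sq j (R := R).
have -> : msign i * X i 0 ^+ 2 + msign j * X j 0 ^+ 2 =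
  (c ^+ 2 + msign i * msign j * s ^+ 2) *
    (msign i * X i 0 ^+ 2 + msign j * X j 0 ^+ 2) by rewrite cs mul1r.
ring: ei ej.
Qed.

Lemma givens_mulVl {R : realType} (i j : 'I_4) (c s : R) :
  i != j -> c ^+ 2 + msign i * msign j * s ^+ 2 = 1 ->
  givens i j c (- s) *m givens i j c s = 1%:M.
Proof.
move=> /negbTE ij cs; apply/matrixP => k l.
have {}cs : c ^+ 2 = 1 - msign i * msign j * s ^+ 2 by rewrite -cs addrK.
(* Appending an identity matrix lets the row formula [mul_givens] evaluate both factors. *)
rewrite -(mulmx1 (givens i j c s)) mulmxA -mulmxA !(mul_givens, eqxx).
rewrite [j == i]eq_sym ij.
case: eqP => [->|_]; first by ring: cs.
by case: eqP => [->|_] //; ring: cs.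
Qed.

Lemma lorentz_givens {R : realType} (i j : 'I_4) (c s : R) :
  i != j -> c ^+ 2 + msign i * msign j * s ^+ 2 = 1 ->
  lorentz_affine R (givens i j c s, 0).
Proof.
move=> ij cs; split=> [|X] /=; last exact: lorentz_form_givens.
by have /mulmx1_unit[] := givens_mulVl _ _ _ _ ij cs.
Qed.

(** * Paths from the identity in the Lorentz group *)

Lemma continuous_givens {R : realType} (i j : 'I_4) (c s : R -> R) :
  continuous c -> continuous s ->
  continuous (fun t => (givens i j (c t) (s t), 0) : affine R).
Proof.
move=> cc cs t.
suff cg : continuous (fun u => givens i j (c u) (s u)).
  exact: (cvg_pair (cg t) (cvg_cst (0 : 'cV[R]_4))).
apply: (@continuous_mx R R 3 3) => k l {}t.
rewrite (_ : (fun _ => _) = fun t =>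
    if k == i then c t * (l == i)%:R + s t * (l == j)%:R
    else if k == j
      then - (msign i * msign j * s t) * (l == i)%:R + c t * (l == j)%:R
    else (k == l)%:R); last by apply/funext => x; rewrite mxE.
case: (k == i); [|case: (k == j)].
- by apply: cvgD; apply: cvgMr_tmp; [exact: cc|exact: cs].
- apply: cvgD; apply: cvgMr_tmp; last exact: cc.
  by apply: cvgN; apply: cvgMl_tmp; exact: cs.
- exact: cvg_cst.
Qed.

Lemma poincare_path {R : realType} (f : R -> affine R) (t u : R) :
  continuous f -> (forall x, lorentz_affine R (f x)) -> f t = affine_one R ->
  poincare R (f u).
Proof.
move=> cf lf f0; exists (range f); last by exists u.
split.
- by rewrite -f0; exists t.
- by move=> _ [x _ <-].
- apply: connected_continuous_connected; last exact: continuous_subspaceT.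
  by apply/connected_intervalP.
Qed.

Lemma givens10 {R : realType} (i j : 'I_4) : givens i j 1 0 = 1%:M :> 'M[R]_4.
Proof.
apply/matrixP => k l; rewrite !mxE; case: eqP => [->|_].
  by rewrite mul1r mul0r addr0 eq_sym.
case: eqP => [->|//].
by rewrite mulr0 oppr0 mul0r mul1r add0r eq_sym.
Qed.

Lemma poincare_rotation {R : realType} (i j : 'I_4) (c s : R) :
  i != 3 -> j != 3 -> i != j -> c ^+ 2 + s ^+ 2 = 1 ->
  poincare R (givens i j c s, 0).
Proof.
move=> i3 j3 ij cs.
(* The arccosine fixes the angle up to sign; the sign of [s] decides between the two. *)
have [t [<- <-]] : exists t, cos t = c /\ sin t = s.
  have s0 := sqr_ge0 s; have c0 := sqr_ge0 c.
  have c1 : -1 <= c <= 1 by nra.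
  have sa := sin_acos c1; have [_ ca] := acos_def c1.
  have {sa} : sin (acos c) = `|s|.
    by rewrite sa (_ : 1 - c ^+ 2 = s ^+ 2) ?sqrtr_sqr//; lra.
  case: (ger0P s) => _ sa; first by exists (acos c).
  by exists (- acos c); rewrite cosN sinN sa opprK.
apply: (@poincare_path R (fun t => (givens i j (cos t) (sin t), 0)) 0).
- by apply: continuous_givens; [exact: continuous_cos|exact: continuous_sin].
- move=> x; apply: lorentz_givens => //.
  by rewrite !msign_spatial// !mul1r cos2Dsin2.
- by rewrite cos0 sin0 givens10.
Qed.

Lemma poincare_boost {R : realType} (i : 'I_4) (c s : R) :
  i != 3 -> 0 < c -> c ^+ 2 - s ^+ 2 = 1 -> poincare R (givens i 3 c s, 0).
Proof.
move=> i3 c0 cs.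
pose ch (t : R) := (expR t + expR (- t)) / 2.
pose sh (t : R) := (expR t - expR (- t)) / 2.
have e t : expR t * expR (- t) = 1 :> R by rewrite -expRD subrr expR0.
have [t [<- <-]] : exists t, ch t = c /\ sh t = s.
  have p : 0 < c + s by nra.
  (* The rapidity: cosh + sinh = exp, and [c - s] is the inverse of [c + s]. *)
  exists (ln (c + s)).
  have := e (ln (c + s)); rewrite /ch /sh lnK ?posrE// => e1.
  have -> : expR (- ln (c + s)) = c - s.
    by apply: (mulfI (lt0r_neq0 p)); rewrite e1 -cs; ring.
  by split; field.
have cN : continuous (fun t : R => expR (- t)).
  move=> x; apply: (@continuous_comp _ _ _ (fun t : R => - t)) => //.
    exact: opp_continuous.
  exact: continuous_expR.
apply: (@poincare_path R (fun t => (givens i 3 (ch t) (sh t), 0)) 0).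
- apply: continuous_givens => x; apply: cvgMr_tmp.
    by apply: cvgD; [exact: continuous_expR|exact: cN].
  by apply: cvgB; [exact: continuous_expR|exact: cN].
- move=> x; apply: lorentz_givens => //.
  rewrite msign3 msign_spatial// /ch /sh; by have ex := e x; field: ex.
- by rewrite /ch /sh oppr0 expR0 subrr mul0r divff ?pnatr_eq0// givens10.
Qed.

Lemma poincare_translation {R : realType} (C : 'cV[R]_4) : poincare R (1%:M, C).
Proof.
rewrite -(scale1r C).
apply: (@poincare_path R (fun t => (1%:M, t *: C)) 0).
- move=> t.
  have cC : {for t, continuous (fun u : R => u *: C)}.
    by apply: cvgZr_tmp; exact: cvg_id.
  exact: (cvg_pair (cvg_cst (1%:M : 'M[R]_4)) cC).
- by move=> t; split=> [|X] /=; rewrite ?unitmx1 ?mul1mx.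
- by rewrite scale0r.
Qed.

(** For [j = 3] the relation between [c] and [s] is a hyperbola, and only its branch [0 < c]
    contains the identity; for spatial [j] it is a circle, which is connected. *)
Lemma poincare_givens {R : realType} (i j : 'I_4) (c s : R) :
  i != 3 -> i != j -> c ^+ 2 + msign i * msign j * s ^+ 2 = 1 ->
  (j = 3 -> 0 < c) -> poincare R (givens i j c s, 0).
Proof.
move=> i3 ij; rewrite msign_spatial// mul1r.
have [->|j3] := eqVneq j 3.
  by rewrite msign3 mulN1r => cs /(_ erefl) c0; exact: poincare_boost.
by rewrite msign_spatial// mul1r => cs _; exact: poincare_rotation.
Qed.

(** * Vanishing on plane transformations and translations *)

Lemma affine_mul_linear {R : realType} (A B : 'M[R]_4) :
  affine_mul (A, 0) (B, 0) = (A *m B, 0).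
Proof. by rewrite /affine_mul /= mulmx0 addr0. Qed.

Lemma affine_mul_decomp {R : realType} (g : affine R) :
  affine_mul (1%:M, g.2) (g.1, 0) = g.
Proof. by case: g => L C; rewrite /affine_mul /= mul1mx mulmx0 add0r. Qed.

(** Provides the second axis of the half-turn; the case [i = j] serves the spatial translations. *)
Lemma exists_spatial (i j : 'I_4) :
  exists k : 'I_4, [/\ k != 3, i != k & j != k].
Proof.
elim/ord4_ind: i; elim/ord4_ind: j;
  by [exists 0|exists 1|exists 2].
Qed.

Definition poincare_hom {R : realType} (phi : affine R -> R) :=
  forall g h, poincare R g -> poincare R h ->
    phi (affine_mul g h) = phi g + phi h.

Lemma hom_one {R : realType} (phi : affine R -> R) :
  poincare_hom phi -> phi (affine_one R) = 0.
Proof.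
move=> /(_ _ _ (poincare1 R) (poincare1 R)); rewrite affine_mulg1 => /eqP.
by rewrite -subr_eq0 opprD addNKr oppr_eq0 => /eqP.
Qed.

Lemma hom_involution {R : realType} (phi : affine R -> R) (g : affine R) :
  poincare_hom phi -> poincare R g -> affine_mul g g = affine_one R ->
  phi g = 0.
Proof.
move=> hphi Pg gg; have := hphi _ _ Pg Pg; rewrite gg hom_one//; lra.
Qed.

Lemma poincare_half_turn {R : realType} (i k : 'I_4) :
  i != 3 -> k != 3 -> i != k -> poincare R (givens i k (-1) 0, 0).
Proof.
move=> i3 k3 ik.
by apply: poincare_rotation; rewrite // sqrrN expr1n expr0n addr0.
Qed.

Lemma half_turn_sq {R : realType} (i k : 'I_4) : i != k ->
  givens i k (-1) 0 *m givens i k (-1) 0 = 1%:M :> 'M[R]_4.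
Proof.
move=> ik; have := givens_mulVl (R := R) i k (-1) 0 ik; rewrite oppr0; apply.
by rewrite sqrrN expr1n expr0n mulr0 addr0.
Qed.

(** The half-turn negates the axes [i] and [k] and fixes [j], so conjugation keeps the diagonal
    coefficients and negates those mixing [i] with [j]. *)
Lemma half_turn_conj {R : realType} (i j k : 'I_4) (c s : R) :
  i != j -> i != k -> j != k ->
  givens i k (-1) 0 *m givens i j c s *m givens i k (-1) 0 = givens i j c (- s).
Proof.
move=> /negbTE ij /negbTE ik /negbTE jk; apply/matrixP => l m.
rewrite -(mulmx1 (givens i k (-1) 0)) -[in RHS](mulmx1 (givens i j c (- s))).
rewrite -!mulmxA !mul1mx !(mul_givens, eqxx).
rewrite [j == i]eq_sym [k == i]eq_sym [k == j]eq_sym ij ik jk.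
case: (eqVneq l i) => [_|_]; first by ring.
case: (eqVneq l k) => [->|_]; last by case: eqP => _; ring.
rewrite [k == j]eq_sym jk; ring.
Qed.

(* A half-turn in a plane (i, k) inverts every element of the plane (i, j);
   the target being abelian, such an element is sent to its own opposite. *)
Lemma hom_givens {R : realType} (phi : affine R -> R) (i j : 'I_4) (c s : R) :
  poincare_hom phi -> i != 3 -> i != j ->
  c ^+ 2 + msign i * msign j * s ^+ 2 = 1 -> (j = 3 -> 0 < c) ->
  phi (givens i j c s, 0) = 0.
Proof.
move=> hphi i3 ij cs c0; have [k [k3 ik jk]] := exists_spatial i j.
have PD := poincare_half_turn (R := R) _ _ i3 k3 ik.
have PG := poincare_givens _ _ _ _ i3 ij cs c0.
have D0 : phi (givens i k (-1) 0, 0) = 0.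
  apply: hom_involution => //.
  by rewrite affine_mul_linear half_turn_sq.
have PDG := poincareM PD PG.
have := hphi _ _ PDG PD; rewrite (hphi _ _ PD PG) D0 !affine_mul_linear.
rewrite half_turn_conj// addr0 add0r => eG.
have PG' : poincare R (givens i j c (- s), 0).
  by rewrite -(half_turn_conj i j k)// -!affine_mul_linear; exact: poincareM.
have := hphi _ _ PG' PG; rewrite affine_mul_linear givens_mulVl// eG hom_one//.
by lra.
Qed.

Lemma hom_translationD {R : realType} (phi : affine R -> R) (C D : 'cV[R]_4) :
  poincare_hom phi -> phi (1%:M, C + D) = phi (1%:M, C) + phi (1%:M, D).
Proof.
move=> hphi; rewrite -hphi; try exact: poincare_translation.
by rewrite /affine_mul /= !mul1mx addrC.
Qed.

(** Translating by [L *m C] after [L] is the same as applying [L] after translating by [C], and the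
    target is abelian. *)
Lemma hom_translation_conj {R : realType} (phi : affine R -> R)
    (L : 'M[R]_4) (C : 'cV[R]_4) :
  poincare_hom phi -> poincare R (L, 0) -> phi (1%:M, L *m C) = phi (1%:M, C).
Proof.
move=> hphi PL; have PT := poincare_translation (R := R).
apply: (@addIr _ (phi (L, 0))); rewrite -(hphi _ _ (PT _) PL).
rewrite [RHS]addrC -(hphi _ _ PL (PT _)).
by rewrite /affine_mul /= mul1mx mulmx1 mulmx0 add0r addr0.
Qed.

(** A half-turn reverses the translation vector, so a translation and its inverse have the same
    value; these two values also add up to 0. *)
Lemma hom_translation_spatial {R : realType} (phi : affine R -> R)
    (i : 'I_4) (a : R) :
  poincare_hom phi -> i != 3 -> phi (1%:M, a *: delta_mx i 0) = 0.
Proof.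
move=> hphi i3; have [k [k3 ik _]] := exists_spatial i i.
have := hom_translation_conj phi _ (a *: delta_mx i 0) hphi
  (poincare_half_turn _ _ i3 k3 ik).
rewrite (_ : _ *m _ = - (a *: delta_mx i 0)); last first.
  apply/matrixP => l m; rewrite mul_givens !mxE !ord1 !eqxx [k == i]eq_sym.
  rewrite (negbTE ik) !andbT; case: (eqVneq l i) => [_|_] /=; first by ring.
  by case: (l == k); ring.
move=> e.
have := hom_translationD phi (a *: delta_mx i 0) (- (a *: delta_mx i 0)) hphi.
by rewrite subrr e (hom_one _ hphi); lra.
Qed.

Lemma hom_translation {R : realType} (phi : affine R -> R) (C : 'cV[R]_4) :
  poincare_hom phi -> phi (1%:M, C) = 0.
Proof.
move=> hphi.
have time a : phi (1%:M, a *: delta_mx 3 0) = 0.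
  (* A rational point of the hyperbola: 25/16 - 9/16 = 1. *)
  have P03 : poincare R (givens 0 3 (5 / 4) (3 / 4), 0).
    by apply: poincare_boost => //; lra.
  (* The boost B multiplies e_t by 5/4 modulo space, so (B - 1) e_t covers
     e_t / 4. *)
  have := hom_translation_conj phi _ ((4 * a) *: delta_mx 3 0) hphi P03.
  rewrite (_ : _ *m _ = (3 * a) *: delta_mx 0 0 +
    ((4 * a) *: delta_mx 3 0 + a *: delta_mx 3 0)); last first.
    apply/matrixP => l m.
    rewrite mul_givens !mxE !ord1 !eqxx msign3 msign_spatial//.
    by elim/ord4_ind: l => /=; field.
  rewrite !hom_translationD// hom_translation_spatial//; lra.
rewrite (matrix_sum_delta C).
rewrite (big_morph (fun C => phi (1%:M, C)) (id1 := 0) (op1 := +%R));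
  first last.
- exact: hom_one.
- by move=> x y; exact: hom_translationD.
apply: big1 => i _; rewrite big_ord1.
have [->|i3] := eqVneq i 3; first exact: time.
exact: hom_translation_spatial.
Qed.

(** * Gram relations and the signs constant on the identity component *)

Lemma lorentz_gram {R : realType} (g : affine R) (a b : 'I_4) :
  lorentz_affine R g ->
  \sum_k msign k * (g.1 k a * g.1 k b) = msign a * (a == b)%:R.
Proof.
case: g => L C [_ /= form].
have diag x : \sum_k msign k * (L k x * L k x) = msign x.
  transitivity (lorentz_form (L *m delta_mx x 0)).
    by rewrite lorentz_formE -colE; apply: eq_bigr => k _; rewrite mxE expr2.
  rewrite form lorentz_formE (bigD1 x)//= big1 ?addr0 => [|k /negbTE kx].
    by rewrite mxE !eqxx expr1n mulr1.
  by rewrite mxE kx expr0n mulr0.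
have [<-|ab] := eqVneq a b; first by rewrite diag mulr1.
(* Polarization: the form on a sum of two basis vectors determines the mixed products. *)
have := form (delta_mx a 0 + delta_mx b 0).
rewrite !lorentz_formE mulmxDr -!colE.
have -> : \sum_k msign k * (col a L + col b L) k 0 ^+ 2 =
    \sum_k msign k * (L k a * L k a) + \sum_k msign k * (L k b * L k b)
    + 2 * \sum_k msign k * (L k a * L k b).
  rewrite mulr_sumr -!big_split/=; apply: eq_bigr => k _; rewrite !mxE; ring.
have -> :
    \sum_k msign k * (delta_mx a 0 + delta_mx b 0 : 'cV[R]_4) k 0 ^+ 2 =
    msign a + msign b.
  rewrite (bigD1 a)//= (bigD1 b) 1?eq_sym//= big1; first last.
    move=> k /andP[/negbTE ka /negbTE kb].
    by rewrite !mxE ka kb addr0 expr0n mulr0.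
  by rewrite !mxE !eqxx [b == a]eq_sym (negbTE ab)/=; ring.
by rewrite !diag mulr0; lra.
Qed.

(** Intermediate values: the image of the component is a connected subset of the line that avoids 0
    and contains a positive number. *)
Lemma poincare_gt0 {R : realType} (f : affine R -> R) (g : affine R) :
  continuous f -> (forall h, lorentz_affine R h -> f h != 0) ->
  0 < f (affine_one R) -> poincare R g -> 0 < f g.
Proof.
move=> cf f0 f1 Pg.
have cfP : connected (f @` poincare R).
  apply: connected_continuous_connected; last exact: continuous_subspaceT.
  exact: component_connected.
rewrite ltNge; apply/negP => fg.
have /connected_intervalP/(_ (f g) (f (affine_one R))) := cfP.
case/(_ _ _ 0) => [||| h Ph /eqP fh].
- by exists g.
- by exists (affine_one R) => //; exact: poincare1.
- by rewrite fg ltW.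
- by have := f0 _ (poincare_sub Ph); rewrite fh.
Qed.

Lemma continuous_affine_coord {R : realType} (i j : 'I_4) :
  continuous (fun g : affine R => g.1 i j).
Proof.
move=> g; apply: (@continuous_comp _ _ _ (fun h : affine R => h.1)
  (fun B : 'M[R]_4 => B i j)); first exact: cvg_fst.
exact: coord_continuous.
Qed.

Lemma continuous_affine_det {R : realType} :
  continuous (fun g : affine R => \det g.1).
Proof.
move=> g; rewrite /determinant.
apply: cvg_big => [|s _]; first exact: add_continuous.
apply: cvgMl_tmp.
apply: cvg_big => [|i _]; first exact: mul_continuous.
exact: continuous_affine_coord.
Qed.

Lemma poincare_det_gt0 {R : realType} (g : affine R) :
  poincare R g -> 0 < \det g.1.
Proof.
apply: (poincare_gt0 (fun g => \det g.1)); first exact: continuous_affine_det.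
- by move=> h [+ _]; rewrite unitmxE unitfE.
- by rewrite /= det1.
Qed.

Lemma lorentz_time_col {R : realType} (g : affine R) : lorentz_affine R g ->
  g.1 3 3 ^+ 2 = 1 + g.1 0 3 ^+ 2 + g.1 1 3 ^+ 2 + g.1 2 3 ^+ 2.
Proof.
move=> /(lorentz_gram g 3 3).
rewrite big_ord4 msign3 !msign_spatial// eqxx mulr1; lra.
Qed.

Lemma poincare_time_gt0 {R : realType} (g : affine R) :
  poincare R g -> 0 < g.1 3 3.
Proof.
apply: (poincare_gt0 (fun g => g.1 3 3)).
- exact: continuous_affine_coord.
(* The square of this entry is 1 plus a sum of squares. *)
- move=> h /lorentz_time_col e; apply/eqP => h0; move: e; rewrite h0.
  have := sqr_ge0 (h.1 0 3); have := sqr_ge0 (h.1 1 3).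
  have := sqr_ge0 (h.1 2 3); rewrite expr0n /=; lra.
- by rewrite mxE eqxx ltr01.
Qed.

(** * Elimination by rotations and boosts *)

(** Agreement with the identity outside the leading block of size [n]: a vacuous condition for
    [n = 4], and [L = 1%:M] for [n = 0]. *)
Definition unit_from {R : realType} (n : nat) (L : 'M[R]_4) :=
  forall k l : 'I_4, (n <= maxn k l)%N -> L k l = (k == l)%:R.

(** Only rows [i] and [j] change, and both vanish in the columns beyond the block. *)
Lemma unit_from_mul_givens {R : realType} (n : nat)
    (i j : 'I_4) (c s : R) (L : 'M[R]_4) :
  (i < n)%N -> (j < n)%N -> unit_from n L -> unit_from n (givens i j c s *m L).
Proof.
move=> lin ljn uL k l; rewrite leq_max => kl; rewrite mul_givens.
case: (eqVneq k i) kl => [->|ki].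
  rewrite leqNgt lin /= => nl; rewrite !uL ?leq_max ?nl ?orbT//.
  have /negbTE-> : i != l by apply/eqP => il; move: nl; rewrite -il leqNgt lin.
  have /negbTE-> : j != l by apply/eqP => jl; move: nl; rewrite -jl leqNgt ljn.
  by rewrite !mulr0 addr0.
case: (eqVneq k j) => [->|kj] kl; last by rewrite uL ?leq_max.
have nl : (n <= l)%N by move: kl; rewrite leqNgt ljn.
rewrite !uL ?leq_max ?nl ?orbT//.
have /negbTE-> : i != l by apply/eqP => il; move: nl; rewrite -il leqNgt lin.
have /negbTE-> : j != l by apply/eqP => jl; move: nl; rewrite -jl leqNgt ljn.
by rewrite !mulr0 addr0.
Qed.

(** One elimination step with pivot row [j]; [phi] is unchanged since it vanishes on the factor
    used. The last clause preserves zeros made earlier in the column. *)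
Lemma hom_kill_entry {R : realType} (phi : affine R -> R)
    (i j : 'I_4) (L : 'M[R]_4) :
  poincare_hom phi -> poincare R (L, 0) -> (i < j)%N -> unit_from j.+1 L ->
  exists M : 'M[R]_4, [/\ poincare R (M, 0), phi (M, 0) = phi (L, 0),
    unit_from j.+1 M, M i j = 0 /\ 0 <= M j j &
    forall k, k != i -> k != j -> M k j = L k j].
Proof.
move=> hphi PL ij uL.
have i3 : i != 3.
  by apply/eqP => i3; move: ij; rewrite i3 ltnNge -ltnS ltn_ord.
have nij : i != j by apply/eqP => ij'; move: ij; rewrite ij' ltnn.
(* Up to the sign [msign j], this is the part of the quadratic form of column [j] carried by the
   plane [(i, j)]. For [j = 3] it is at least 1, because the time column is timelike. *)
pose q := L j j ^+ 2 + msign j * L i j ^+ 2.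
have q3 : j = 3 -> 0 < q.
  rewrite /q => ->; have := lorentz_time_col (L, 0) (poincare_sub PL).
  have := sqr_ge0 (L 0 3); have := sqr_ge0 (L 1 3); have := sqr_ge0 (L 2 3).
  rewrite msign3 /=; move: i3; elim/ord4_ind: i {ij nij q} => //=; lra.
(* If [q] is not positive, the plane is spatial and both entries are already 0, so [L] itself
   serves. *)
have [q0|q0] := ltP 0 q; last first.
  have j3 : j != 3 by apply/eqP => /q3; rewrite ltNge q0.
  have := sqr_ge0 (L j j); have := sqr_ge0 (L i j).
  move: q0; rewrite /q msign_spatial// mul1r => q0 Li0 Lj0.
  have Li : L i j ^+ 2 = 0 by lra.
  have Lj : L j j ^+ 2 = 0 by lra.
  exists L; split=> //; split.
    by apply/eqP; rewrite -sqrf_eq0 Li.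
  by move/eqP: Lj; rewrite sqrf_eq0 => /eqP->.
pose r := Num.sqrt q.
have r0 : 0 < r by rewrite sqrtr_gt0.
have rr : r ^+ 2 = q by rewrite sqr_sqrtr// ltW.
(* Chosen so that the pair of entries in rows [i], [j] becomes [0] and [q / r]. *)
pose c := L j j / r; pose s := - (L i j / r).
have cs : c ^+ 2 + msign i * msign j * s ^+ 2 = 1.
  rewrite (msign_spatial i i3) mul1r.
  have -> : c ^+ 2 + msign j * s ^+ 2 = q / r ^+ 2.
    by rewrite /c /s /q; field; rewrite gt_eqF.
  by rewrite rr divff// gt_eqF.
have c0 : j = 3 -> 0 < c.
  move=> j3; rewrite /c divr_gt0// j3; exact: (poincare_time_gt0 (L, 0)).
have PG := poincare_givens _ _ _ _ i3 nij cs c0.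
exists (givens i j c s *m L); rewrite -affine_mul_linear; split.
- exact: poincareM.
- by rewrite hphi// (hom_givens _ _ _ _ _ hphi) ?add0r.
- by apply: unit_from_mul_givens; rewrite // ltnS ltnW.
- rewrite !mul_givens !eqxx [j == i]eq_sym (negbTE nij) (msign_spatial i i3).
  split; first by rewrite /c /s; ring.
  rewrite (_ : _ + _ = q / r) ?divr_ge0 ?ltW//.
  by rewrite /c /s /q; ring.
- by move=> k /negbTE ki /negbTE kj; rewrite mul_givens ki kj.
Qed.

(** Column [j] is a nonnegative multiple of a basis vector; its Gram relation with itself makes the
    multiple 1, and those with the other columns clear row [j]. *)
Lemma lorentz_unit_from {R : realType} (j : 'I_4) (L : 'M[R]_4) :
  lorentz_affine R (L, 0) -> unit_from j.+1 L ->
  (forall i : 'I_4, (i < j)%N -> L i j = 0) -> 0 <= L j j -> unit_from j L.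
Proof.
move=> HL uL Lj0 Ljj k l.
have col k' : k' != j -> L k' j = 0.
  rewrite neq_ltn => /orP[/Lj0//|jk']; rewrite uL ?leq_max ?jk'//.
  by case: eqP jk' => // ->; rewrite ltnn.
have gram a : msign j * (L j a * L j j) = msign a * (a == j)%:R.
  rewrite -(lorentz_gram _ a j HL) (bigD1 j)//= big1 ?addr0// => k' k'j.
  by rewrite (col k') ?mulr0.
have e2 := msign_sq j (R := R).
have Ljj1 : L j j = 1.
  have := gram j; rewrite eqxx => e; apply/eqP; rewrite -sqrp_eq1//.
  by apply/eqP; rewrite expr2 -[_ * _]mul1r -e2 -mulrA e mulr1 e2.
have row a : a != j -> L j a = 0.
  move=> /negbTE aj; have := gram a; rewrite Ljj1 aj mulr1 mulr0 => e.
  by rewrite -[L j a]mul1r -e2 -mulrA e mulr0.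
have [-> _|kj] := eqVneq k j.
  by have [<-//|lj] := eqVneq j l; rewrite ?row// eq_sym.
have [-> _|lj] := eqVneq l j; first by rewrite col// (negbTE kj).
move=> jkl; apply: uL; move: jkl; rewrite !leq_max.
by rewrite leq_eqVlt eq_sym (negbTE kj : (k == j :> nat) = false) /=
  [(j <= l)%N]leq_eqVlt eq_sym (negbTE lj : (l == j :> nat) = false).
Qed.

Lemma hom_clear_column {R : realType} (phi : affine R -> R)
    (j : 'I_4) (L : 'M[R]_4) :
  poincare_hom phi -> poincare R (L, 0) -> (0 < j)%N -> unit_from j.+1 L ->
  exists M : 'M[R]_4, [/\ poincare R (M, 0), phi (M, 0) = phi (L, 0) &
    unit_from j M].
Proof.
move=> hphi PL j0 uL.
have [M [PM eM uM Mj0 Mjj]] : exists M : 'M[R]_4, [/\ poincare R (M, 0),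
    phi (M, 0) = phi (L, 0), unit_from j.+1 M,
    forall i : 'I_4, (i < j)%N -> M i j = 0 & 0 <= M j j].
  (* Induction on the number of entries cleared from the top of the column. The guard on the sign of
     [M j j] then says that at least one step was made, since each step leaves a nonnegative
     pivot. *)
  suff [M [PM eM uM Mj0 Mjj]] : exists M : 'M[R]_4, [/\ poincare R (M, 0),
      phi (M, 0) = phi (L, 0), unit_from j.+1 M,
      forall i : 'I_4, (i < j)%N -> M i j = 0 & (0 < j)%N -> 0 <= M j j].
    by exists M; split=> //; exact: Mjj.
  elim: {1 4 5}(nat_of_ord j) (leqnn j) => [_|m IHm mj].
    by exists L; split.
  have [M [PM eM uM Mj0 _]] := IHm (ltnW mj).
  pose i : 'I_4 := Ordinal (ltn_trans mj (ltn_ord j)).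
  have [N [PN eN uN [Ni Nj] Nk]] := hom_kill_entry phi i j M hphi PM mj uM.
  exists N; split=> //; first by rewrite eN.
  move=> k; rewrite ltnS leq_eqVlt => /orP[/eqP km|km].
    by rewrite (_ : k = i)//; exact/val_inj.
  rewrite Nk ?Mj0//; first by apply: contraTneq km => ->; rewrite ltnn.
  by apply: contraTneq km => ->; rewrite -leqNgt ltnW.
exists M; split=> //; apply: lorentz_unit_from => //; exact: poincare_sub.
Qed.

Lemma hom_linear {R : realType} (phi : affine R -> R) (L : 'M[R]_4) :
  poincare_hom phi -> poincare R (L, 0) -> phi (L, 0) = 0.
Proof.
move=> hphi PL0.
have uL : unit_from 4 L.
  by move=> k l; rewrite leqNgt gtn_max !ltn_ord.
have [L3 [PL3 <- u3]] := hom_clear_column phi 3 L hphi PL0 isT uL.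
have [L2 [PL2 <- u2]] := hom_clear_column phi 2 L3 hphi PL3 isT u3.
have [L1 [PL1 <- u1]] := hom_clear_column phi 1 L2 hphi PL2 isT u2.
(* Only the entry [L1 0 0] may still differ from the identity; it equals the determinant, whose
   positivity excludes -1. *)
have u0 : unit_from 0 L1.
  apply: (@lorentz_unit_from R 0) => //; first exact: poincare_sub.
  have := poincare_det_gt0 (L1, 0) PL1.
  have -> : L1 = diag_mx (\row_k L1 k k).
    apply/matrixP => k l; rewrite !mxE.
    have [->|kl] := eqVneq k l; first by rewrite mulr1n.
    rewrite mulr0n u1; first by rewrite (negbTE kl).
    by move: kl; elim/ord4_ind: k; elim/ord4_ind: l.
  rewrite /= det_diag big_ord_recl big1 => [|k _].
    by rewrite mulr1 !mxE mulr1n => /ltW.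
  by rewrite mxE u1 ?eqxx ?leq_max.
have -> : L1 = 1%:M by apply/matrixP => k l; rewrite u0// mxE.
exact: (hom_one _ hphi).
Qed.

Lemma hom_poincare_trivial {R : realType} (phi : affine R -> R) (g : affine R) :
  poincare_hom phi -> poincare R g -> phi g = 0.
Proof.
move=> hphi Pg.
have PT := poincare_translation g.2.
(* The linear part stays in the component because it is [g] followed by a translation. *)
have PL : poincare R (g.1, 0).
  rewrite (_ : (g.1, 0) = affine_mul (affine_inv (1%:M, g.2)) g).
    by apply: poincareM => //; exact: poincareV.
  by rewrite /affine_mul /affine_inv /= invmx1 !mul1mx subrr.
by rewrite -(affine_mul_decomp g) hphi// hom_translation// hom_linear// addr0.
Qed.

Theorem mainTheorem6 (R : realType) :
  ~ exists phi : affine R -> R,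
      [/\ smooth_on (poincare R) phi,
          forall g h : affine R, poincare R g -> poincare R h ->
            phi (affine_mul g h) = phi g + phi h &
          set_surj (poincare R) [set: R] phi].
Proof.
case=> phi [_ hphi /(_ 1 I)[g Pg]].
by rewrite hom_poincare_trivial// => /eqP; rewrite eq_sym oner_eq0.
Qed.
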